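(* Let $p\in\mathbb H$, $R>0$, and let $f$ be a left slice hyperholomorphic function in an axially symmetric open neighbourhood of $p$ containing the Cassini ball $U(p,R)$, where it admits a spherical expansion $$f(q)=\sum_{n=0}^\infty Q_p^n(q)a_{2n}+\sum_{n=0}^\infty Q_p^n(q)(q-p)a_{2n+1},\qquad\{a_n\}_{n\in\mathbb N_0}\subset\mathbb H,$$ convergent absolutely and uniformly on the compact subsets of $U(p,R)$. Let $g=Df$. Then $$g(q)=-4\sum_{n=1}^\infty\mathcal L_n(q,p)(q_0-p_0)\,[a_{2n}+(\bar q-p)a_{2n+1}]-2\sum_{n=0}^\infty Q_p^n(q)a_{2n+1},$$ which can also be written as $$g(q)=-4\sum_{n=1}^\infty\mathcal L_n(q,p)(q_0-p_0)\,[a_{2n}+(q-p)a_{2n+1}]-2\sum_{n=0}^\infty Q_p^n(\bar q)a_{2n+1},$$ the series being convergent absolutely and uniformly on the compact subsets of $U(p,R)$.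
   Context: $\mathbb H$ denotes the quaternions $q=q_0+q_1e_1+q_2e_2+q_3e_3$ with the usual relations ($e_i^2=-1$, $e_1e_2=-e_2e_1=e_3$, $e_2e_3=-e_3e_2=e_1$, $e_3e_1=-e_1e_3=e_2$), $\underline q=q_1e_1+q_2e_2+q_3e_3$, $\bar q=q_0-\underline q$, $\mathbb S=\{\underline q:|\underline q|=1\}$, $[q]=\{q_0+I|\underline q|:I\in\mathbb S\}$; a set $U$ is axially symmetric if $[q]\subset U$ for all $q\in U$. Slice hyperholomorphic: for $U$ axially symmetric open and $\mathcal U=\{(u,v)\in\mathbb R^2:u+\mathbb Sv\subset U\}$, $f:U\to\mathbb H$ is left slice hyperholomorphic if $f(u+Iv)=\alpha(u,v)+I\beta(u,v)$ for all $(u,v)\in\mathcal U$, $I\in\mathbb S$, with $C^1$ functions $\alpha,\beta:\mathcal U\to\mathbb H$, $\alpha$ even and $\beta$ odd in $v$, satisfying $\partial_u\alpha=\partial_v\beta$, $\partial_v\alpha=-\partial_u\beta$. $D=\partial_{q_0}+e_1\partial_{q_1}+e_2\partial_{q_2}+e_3\partial_{q_3}$ acting from the left, in $q$. $p_0=\mathrm{Re}(p)$; $Q_p(q)=q^2-2p_0q+|p|^2$ and $Q_p^n(q)=(Q_p(q))^n$. The Cassini ball is $U(p,R)=\{q\in\mathbb H:|Q_p(q)|<R^2\}$. For $n\ge1$, $$\mathcal L_n(q,p)=\sum_{k=0}^{n-1}\overline{Q_p^{\,n-1-k}(q)}\,Q_p^k(q).$$ *)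

(* Defs.v *)
From HB Require Import structures.
From mathcomp Require Import all_boot all_order all_algebra.
From mathcomp Require Import ring.
From mathcomp Require Import all_classical all_reals all_analysis.

Set Implicit Arguments.
Unset Strict Implicit.
Unset Printing Implicit Defensive.

Import Order.TTheory GRing.Theory Num.Theory.
Import numFieldNormedType.Exports.

Local Open Scope classical_set_scope.
Local Open Scope ring_scope.

Record quat (R : Type) : Type := Quat { qre : R; qi1 : R; qi2 : R; qi3 : R }.

Section quat_choice.
Variable R : Type.

Definition quat_to_tuple (q : quat R) : R * R * R * R :=
  (qre q, qi1 q, qi2 q, qi3 q).

Definition tuple_to_quat (t : R * R * R * R) : quat R :=
  Quat t.1.1.1 t.1.1.2 t.1.2 t.2.

Lemma quat_to_tupleK : cancel quat_to_tuple tuple_to_quat.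
Proof. by case. Qed.

End quat_choice.

HB.instance Definition _ (R : choiceType) :=
  Choice.copy (quat R) (can_type (@quat_to_tupleK R)).

Section quat_algebra.
Variable R : realType.
Implicit Types x y z : quat R.

Lemma quat_ext x y :
  qre x = qre y -> qi1 x = qi1 y -> qi2 x = qi2 y -> qi3 x = qi3 y -> x = y.
Proof. by case: x y => [? ? ? ?] [? ? ? ?] /= -> -> -> ->. Qed.

Definition quat_add x y : quat R :=
  Quat (qre x + qre y) (qi1 x + qi1 y) (qi2 x + qi2 y) (qi3 x + qi3 y).

Definition quat_opp x : quat R := Quat (- qre x) (- qi1 x) (- qi2 x) (- qi3 x).

Definition quat_scale (k : R) x : quat R :=
  Quat (k * qre x) (k * qi1 x) (k * qi2 x) (k * qi3 x).

Definition quat_mul x y : quat R :=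
  Quat (qre x * qre y - qi1 x * qi1 y - qi2 x * qi2 y - qi3 x * qi3 y)
       (qre x * qi1 y + qi1 x * qre y + qi2 x * qi3 y - qi3 x * qi2 y)
       (qre x * qi2 y - qi1 x * qi3 y + qi2 x * qre y + qi3 x * qi1 y)
       (qre x * qi3 y + qi1 x * qi2 y - qi2 x * qi1 y + qi3 x * qre y).

Lemma quat_addA : associative quat_add.
Proof. by move=> x y z; apply: quat_ext => /=; rewrite addrA. Qed.

Lemma quat_addC : commutative quat_add.
Proof. by move=> x y; apply: quat_ext => /=; rewrite addrC. Qed.

Lemma quat_add0 : left_id (Quat 0 0 0 0) quat_add.
Proof. by move=> x; apply: quat_ext => /=; rewrite add0r. Qed.

Lemma quat_addN : left_inverse (Quat 0 0 0 0) quat_opp quat_add.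
Proof. by move=> x; apply: quat_ext => /=; rewrite addNr. Qed.

HB.instance Definition _ :=
  GRing.isZmodule.Build (quat R) quat_addA quat_addC quat_add0 quat_addN.

Lemma quat_mulA : associative quat_mul.
Proof. by move=> x y z; apply: quat_ext => /=; ring. Qed.

Lemma quat_1mul : left_id (Quat 1 0 0 0) quat_mul.
Proof. by move=> x; apply: quat_ext => /=; ring. Qed.

Lemma quat_mul1 : right_id (Quat 1 0 0 0) quat_mul.
Proof. by move=> x; apply: quat_ext => /=; ring. Qed.

Lemma quat_mulDl : left_distributive quat_mul +%R.
Proof. by move=> x y z; apply: quat_ext => /=; ring. Qed.

Lemma quat_mulDr : right_distributive quat_mul +%R.
Proof. by move=> x y z; apply: quat_ext => /=; ring. Qed.

Lemma quat_oner_neq0 : Quat 1 0 0 0 != 0 :> quat R.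
Proof. by apply/eqP => -[] /eqP; rewrite oner_eq0. Qed.

HB.instance Definition _ := GRing.Zmodule_isNzRing.Build (quat R)
  quat_mulA quat_1mul quat_mul1 quat_mulDl quat_mulDr quat_oner_neq0.

Lemma quat_scaleA (k l : R) x : quat_scale k (quat_scale l x) = quat_scale (k * l) x.
Proof. by apply: quat_ext => /=; rewrite mulrA. Qed.

Lemma quat_scale1 : left_id 1 quat_scale.
Proof. by move=> x; apply: quat_ext => /=; rewrite mul1r. Qed.

Lemma quat_scaleDr : right_distributive quat_scale +%R.
Proof. by move=> k x y; apply: quat_ext => /=; rewrite mulrDr. Qed.

Lemma quat_scaleDl x : {morph quat_scale^~ x : k l / k + l}.
Proof. by move=> k l; apply: quat_ext => /=; rewrite mulrDl. Qed.

HB.instance Definition _ := GRing.Zmodule_isLmodule.Build R (quat R)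
  quat_scaleA quat_scale1 quat_scaleDr quat_scaleDl.

Lemma quat_scaleAl (k : R) x y : k *: (x * y) = k *: x * y.
Proof. by apply: quat_ext => /=; ring. Qed.

HB.instance Definition _ := GRing.Lmodule_isLalgebra.Build R (quat R) quat_scaleAl.

Lemma quat_scaleAr (k : R) x y : k *: (x * y) = x * (k *: y).
Proof. by apply: quat_ext => /=; ring. Qed.

HB.instance Definition _ := GRing.Lalgebra_isAlgebra.Build R (quat R) quat_scaleAr.

Definition qnorm x : R :=
  Num.sqrt (qre x ^+ 2 + qi1 x ^+ 2 + qi2 x ^+ 2 + qi3 x ^+ 2).

Let sqn x := qre x ^+ 2 + qi1 x ^+ 2 + qi2 x ^+ 2 + qi3 x ^+ 2.

Let sqn_ge0 x : 0 <= sqn x.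
Proof. by rewrite /sqn !addr_ge0 ?sqr_ge0. Qed.

Lemma ler_qnormD x y : qnorm (x + y) <= qnorm x + qnorm y.
Proof.
pose d := qre x * qre y + qi1 x * qi1 y + qi2 x * qi2 y + qi3 x * qi3 y.
have Lagrange : sqn x * sqn y - d ^+ 2 =
    (qre x * qi1 y - qi1 x * qre y) ^+ 2 +
    (qre x * qi2 y - qi2 x * qre y) ^+ 2 +
    (qre x * qi3 y - qi3 x * qre y) ^+ 2 +
    (qi1 x * qi2 y - qi2 x * qi1 y) ^+ 2 +
    (qi1 x * qi3 y - qi3 x * qi1 y) ^+ 2 +
    (qi2 x * qi3 y - qi3 x * qi2 y) ^+ 2 by rewrite /sqn /d; ring.
have CS : d ^+ 2 <= sqn x * sqn y.
  by rewrite -subr_ge0 Lagrange !addr_ge0 ?sqr_ge0.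
have d_le : d <= qnorm x * qnorm y.
  rewrite /qnorm -!/(sqn _) -sqrtrM// (le_trans (ler_norm d))//.
  by rewrite -sqrtr_sqr ler_wsqrtr.
rewrite -(@ler_pXn2r _ 2) ?nnegrE ?addr_ge0 ?sqrtr_ge0// sqrrD.
rewrite /qnorm -!/(sqn _) !sqr_sqrtr// in d_le *.
have -> : sqn (x + y) = sqn x + d *+ 2 + sqn y by rewrite /sqn /d /=; ring.
by rewrite lerD2r lerD2l lerMn2r.
Qed.

Lemma qnormZ (k : R) x : qnorm (k *: x) = `|k| * qnorm x.
Proof.
rewrite -sqrtr_sqr -sqrtrM ?sqr_ge0//; congr Num.sqrt; rewrite /=; ring.
Qed.

Lemma qnorm0_eq0 x : qnorm x = 0 -> x = 0.
Proof.
move/eqP; rewrite sqrtr_eq0 => x0.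
have : sqn x == 0 by rewrite eq_le x0 sqn_ge0.
rewrite /sqn !paddr_eq0 ?addr_ge0 ?sqr_ge0// !sqrf_eq0.
by move=> /andP[/andP[/andP[/eqP ? /eqP ?] /eqP ?] /eqP ?]; apply: quat_ext.
Qed.

HB.instance Definition _ :=
  @Lmodule_isNormed.Build R (quat R) qnorm ler_qnormD qnormZ qnorm0_eq0.

End quat_algebra.

Section quat_defs.
Variable R : realType.
Local Notation H := (quat R).
Implicit Types (p q : H) (U : set H).

Definition qe1 : H := Quat 0 1 0 0.
Definition qe2 : H := Quat 0 0 1 0.
Definition qe3 : H := Quat 0 0 0 1.

Definition qvec q : H := Quat 0 (qi1 q) (qi2 q) (qi3 q).

Definition qconj q : H := (qre q)%:A - qvec q.

Definition qsphere : set H := [set I | qre I = 0 /\ `|I| = 1].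

Definition qclass q : set H :=
  [set (qre q)%:A + `|qvec q| *: I | I in qsphere].

Definition axially_symmetric U := forall q, U q -> qclass q `<=` U.

Definition slice_domain U : set (R * R) :=
  [set w | forall I, qsphere I -> U (w.1%:A + w.2 *: I)].

(* For open [D], so that the partial derivatives exist near each point of [D]. *)
Definition C1_on (D : set (R * R)) (h : R * R -> H) := forall w, D w ->
  [/\ derivable h w (1, 0), derivable h w (0, 1),
      {for w, continuous ('D_(1, 0) h)} & {for w, continuous ('D_(0, 1) h)}].

(* [f] is only constrained on [U], and [alpha], [beta] on [slice_domain U]. *)
Definition slice_hyperholomorphic U (f : H -> H) :=
  exists alpha beta : R * R -> H,
  [/\ C1_on (slice_domain U) alpha /\ C1_on (slice_domain U) beta,
      forall u v, slice_domain U (u, v) ->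
        alpha (u, - v) = alpha (u, v) /\ beta (u, - v) = - beta (u, v),
      forall w, slice_domain U w ->
        'D_(1, 0) alpha w = 'D_(0, 1) beta w /\
        'D_(0, 1) alpha w = - 'D_(1, 0) beta w &
      forall u v I, slice_domain U (u, v) -> qsphere I ->
        f (u%:A + v *: I) = alpha (u, v) + I * beta (u, v)].

Definition fueter (f : H -> H) q : H :=
  'D_1 f q + qe1 * 'D_qe1 f q + qe2 * 'D_qe2 f q + qe3 * 'D_qe3 f q.

(* ['D_v f q] is a junk value when the directional derivative does not exist. *)
Definition fueter_derivable (f : H -> H) q :=
  [/\ derivable f q 1, derivable f q qe1, derivable f q qe2 &
      derivable f q qe3].

Definition Qpol p q : H := q ^+ 2 - (2 * qre p) *: q + (`|p| ^+ 2)%:A.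

Definition cassini p (r : R) : set H := [set q | `|Qpol p q| < r ^+ 2].

Definition Lpol (n : nat) q p : H :=
  \sum_(0 <= k < n) qconj (Qpol p q ^+ (n - 1 - k)) * Qpol p q ^+ k.

End quat_defs.

Arguments qe1 {R}.
Arguments qe2 {R}.
Arguments qe3 {R}.

Lemma quat_relations (R : realType) :
  [/\ [/\ qe1 * qe1 = -1 :> quat R, qe2 * qe2 = -1 :> quat R &
          qe3 * qe3 = -1 :> quat R],
      qe1 * qe2 = qe3 :> quat R /\ qe2 * qe1 = - qe3 :> quat R,
      qe2 * qe3 = qe1 :> quat R /\ qe3 * qe2 = - qe1 :> quat R &
      qe3 * qe1 = qe2 :> quat R /\ qe1 * qe3 = - qe2 :> quat R].
Proof. by do !split; apply: quat_ext => /=; ring. Qed.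

(* A limit of partial sums: it is only meaningful for a convergent series. *)
Notation "\sum_ ( m <= i '<oo' ) F" :=
  (\big[+%R/0%R]_(m <= i <oo) F%R) : ring_scope.

Definition cvg_abs_unif_compacts (R : realType) (E : set (quat R)) (m : nat)
    (u : nat -> quat R -> quat R) :=
  (forall q, E q -> cvgn (fun N => \sum_(m <= n < N) `|u n q|)) /\
  (forall K, compact K -> K `<=` E ->
     {uniform K, (fun N q => \sum_(m <= n < N) u n q) @ \oo -->
                 (fun q => \sum_(m <= n <oo) u n q)}).

(* Main.v *)
From HB Require Import structures.
Require Import Defs.
From mathcomp Require Import all_boot all_order all_algebra.
From mathcomp Require Import ring lra.
From mathcomp Require Import all_classical all_reals all_analysis.
Import Order.TTheory GRing.Theory Num.Theory.
Import numFieldNormedType.Exports.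
Local Open Scope classical_set_scope.
Local Open Scope ring_scope.

(* The two expansions merge into the series of Q^n (b_n + (q - p) c_n), with
   b_n = a_{2n} and c_n = a_{2n+1}. For every s in (0, r^2) the function Q takes
   the value - s somewhere on the sphere of real part Re p, and the norm of H is
   multiplicative, so the absolute convergence there makes s^n (|b_n| + |c_n|)
   summable for all s < r^2, even after multiplication by (n+1)^2. Hence the
   series and its termwise directional derivatives are normally convergent on
   {|Q| <= s}, with a second-order remainder bounded by t^2 times a summable
   sequence, and the Fueter operator D may be applied termwise.
   Since D (q |-> x q) = - 2 conj x, induction on n gives
   D (Q^n) = - 4 (q_0 - p_0) L_n, whence the second form of the expansion; the
   first one follows from L_n (Q - conj Q) = Q^n - conj Q^n and
   Q - conj Q = 2 (q_0 - p_0) (q - conj q). *)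

(** * Series in a complete normed space dominated by a summable real sequence *)

Section dominated_series.
Context {R : realType} {V : completeNormedModType R}.
Implicit Types (u : nat -> V) (c : nat -> R) (m : nat).

Lemma dominated_cvgn_norm {W : normedModType R} {u : nat -> W} {c} m :
  (forall n, `|u n| <= c n) -> cvgn (series c) ->
  cvgn (fun N => \sum_(m <= n < N) `|u n|).
Proof.
move=> uc cc; rewrite is_cvg_series_restrict.
by apply: series_le_cvg cc => // n; rewrite (le_trans _ (uc n)).
Qed.

Lemma dominated_cvgn {u c} m :
  (forall n, `|u n| <= c n) -> cvgn (series c) ->
  cvgn (fun N => \sum_(m <= n < N) u n).
Proof.
move=> uc cc; rewrite is_cvg_series_restrict; apply: normed_cvg.
exact: (dominated_cvgn_norm 0 uc cc).
Qed.

(** A block of terms from [N] to [M] is at most [series c M - series c N]; let [M] tend to infinity.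
    The bound depends on [u] only through [c], which is what yields uniform convergence below. *)
Lemma dominated_tail {u c m N} : (m <= N)%N ->
  (forall n, `|u n| <= c n) -> cvgn (series c) ->
  `|\sum_(m <= n <oo) u n - \sum_(m <= n < N) u n| <= limn (series c) - series c N.
Proof.
move=> mN uc cc; have cu := dominated_cvgn m uc cc.
have c_ge0 n : 0 <= c n by rewrite (le_trans _ (uc n)).
have c_mono : nondecreasing_seq (series c).
  by apply: nondecreasing_series => n _ _; exact: c_ge0.
have lim_diff : `|\sum_(m <= n < M) u n - \sum_(m <= n < N) u n| @[M --> \oo] -->
    `|\sum_(m <= n <oo) u n - \sum_(m <= n < N) u n|.
  by apply: cvg_norm; apply: cvgB; [exact: cu | exact: cvg_cst].
rewrite -(cvg_lim (@Rhausdorff R) lim_diff).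
apply: limr_le; first exact: cvgP lim_diff.
near=> M; have NM : (N <= M)%N by near: M; exact: nbhs_infty_ge.
rewrite (big_cat_nat mN NM)/= addrAC subrr add0r.
apply: (le_trans (ler_norm_sum _ _ _)).
apply: (le_trans (ler_sum _ (fun n _ => uc n))).
by rewrite -sub_series_geq// lerB// nondecreasing_cvgn_le.
Unshelve. all: by end_near. Qed.

Lemma dominated_norm_le {u c} :
  (forall n, `|u n| <= c n) -> cvgn (series c) ->
  `|\sum_(0 <= n <oo) u n| <= limn (series c).
Proof.
move=> uc cc; have := dominated_tail (leqnn 0%N) uc cc.
by rewrite /series/= !big_geq// !subr0.
Qed.

Lemma weierstrass_M_test {T : choiceType} (K : set T) (u : nat -> T -> V) c m :
  (forall n q, K q -> `|u n q| <= c n) -> cvgn (series c) ->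
  {uniform K, (fun N q => \sum_(m <= n < N) u n q) @ \oo -->
              (fun q => \sum_(m <= n <oo) u n q)}.
Proof.
move=> uc cc P /uniform_nbhs[E [entE EP]].
have [e/= e_gt0 eE] : exists2 e : R, 0 < e & [set xy | ball xy.1 e xy.2] `<=` E.
  by move: entE; rewrite -entourage_ballE => -[e ? ?]; exists e.
have : \forall N \near \oo, `|limn (series c) - series c N| < e.
  by move/cvgrPdist_lt : cc => /(_ e e_gt0).
near_simpl => tail_lt; near=> N; apply: EP => q Kq; apply: eE => /=.
rewrite -ball_normE /=.
have mN : (m <= N)%N by near: N; exact: nbhs_infty_ge.
have uqc n : `|u n q| <= c n by exact: uc.
apply: (le_lt_trans (dominated_tail mN uqc cc)).
apply: le_lt_trans (ler_norm _) _; near: N; exact: tail_lt.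
Unshelve. all: by end_near. Qed.

(** Termwise differentiation along a line: summing the second-order remainders shows that the
    difference quotient of [f] is within |t| times the sum of [c] of the sum of [d]. *)
Lemma is_derive_series {W : normedModType R} {f : W -> V} {u : nat -> W -> V}
    {d : nat -> V} {b c : nat -> R} {x e : W} {delta : R} :
  0 < delta ->
  (forall t, `|t| < delta -> cvgn (fun N => \sum_(0 <= n < N) u n (x + t *: e))) ->
  (forall t, `|t| < delta -> f (x + t *: e) = \sum_(0 <= n <oo) u n (x + t *: e)) ->
  (forall n, `|d n| <= b n) -> cvgn (series b) -> cvgn (series c) ->
  (forall t n, `|t| < delta ->
    `|u n (x + t *: e) - u n x - t *: d n| <= t ^+ 2 * c n) ->
  is_derive x e f (\sum_(0 <= n <oo) d n).
Proof.
move=> delta_gt0 cu fE db cb cc rem.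
have cd := dominated_cvgn 0 db cb.
pose C := limn (series c).
(* At [t = delta / 2] the bound [rem] has a nonnegative left side and a positive factor [t ^+ 2]. *)
have c_ge0 n : 0 <= c n.
  have /(_ (delta / 2) n) := rem.
  rewrite gtr0_norm ?divr_gt0// ltr_pdivrMr// mulr_natr mulr2n ltrDl => /(_ delta_gt0).
  move=> /(le_trans (normr_ge0 _)); rewrite pmulr_rge0// exprn_gt0// divr_gt0//.
have C_ge0 : 0 <= C.
  by apply: limr_ge => //; apply: nearW => N; apply: sumr_ge0.
have quot t : t != 0 -> `|t| < delta ->
    `|\sum_(0 <= n <oo) d n - t^-1 *: (f (t *: e + x) - f x)| <= `|t| * C.
  move=> t0 tdelta.
  have fx : f x = \sum_(0 <= n <oo) u n x.
    by have := fE 0; rewrite scale0r addr0 normr0 => ->.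
  have cux : cvgn (fun N => \sum_(0 <= n < N) u n x).
    by have := cu 0; rewrite scale0r addr0 normr0; exact.
  pose v n := u n (x + t *: e) - u n x - t *: d n.
  have vE : \sum_(0 <= n <oo) v n = f (x + t *: e) - f x - t *: \sum_(0 <= n <oo) d n.
    rewrite fE// fx; apply: cvg_lim; first exact: norm_hausdorff.
    rewrite (_ : (fun N => \sum_(0 <= n < N) v n) = fun N =>
        \sum_(0 <= n < N) u n (x + t *: e) - \sum_(0 <= n < N) u n x
        - t *: \sum_(0 <= n < N) d n); last first.
      by apply/funext => N; rewrite !sumrB scaler_sumr.
    by apply: cvgB; [apply: cvgB; [exact: cu|exact: cux]|apply: cvgZl_tmp; exact: cd].
  have -> : \sum_(0 <= n <oo) d n - t^-1 *: (f (t *: e + x) - f x) =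
      - t^-1 *: \sum_(0 <= n <oo) v n.
    rewrite vE [t *: e + x]addrC scaleNr !scalerBr scalerA mulVf// scale1r.
    by rewrite [RHS]opprB.
  rewrite normrZ normrN normfV mulrC ler_pdivrMr ?normr_gt0//.
  have vc n : `|v n| <= (t ^+ 2 * c n) by exact: rem.
  have ctc : cvgn (series (fun n => t ^+ 2 * c n)).
    exact: (@is_cvg_seriesZ R c (t ^+ 2) cc).
  rewrite (le_trans (dominated_norm_le vc ctc))//.
  rewrite (@lim_seriesZ R c (t ^+ 2) cc) -/C.
  by rewrite mulrAC -normrM ger0_norm -?expr2// sqr_ge0.
have lim_quot : h^-1 *: ((f \o shift x) (h *: e) - f x) @[h --> 0^'] -->
    \sum_(0 <= n <oo) d n.
  apply/cvgrPdist_le => eps eps_gt0; near=> h => /=.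
  have h0 : h != 0 by near: h; exact: nbhs_dnbhs_neq.
  have hd : `|h| < delta by near: h; apply: dnbhs0_lt.
  rewrite (le_trans (quot h h0 hd))//.
  (* The denominator [C + 1] stays positive even when [C] is zero. *)
  have : `|h| <= eps / (C + 1).
    by near: h; apply: dnbhs0_le; rewrite divr_gt0// ltr_wpDl.
  rewrite ler_pdivlMr ?ltr_wpDl//; apply: le_trans.
  by rewrite ler_wpM2l// lerDl.
apply: DeriveDef; first by apply/cvg_ex; exists (\sum_(0 <= n <oo) d n).
by apply: cvg_lim lim_quot; exact: norm_hausdorff.
Unshelve. all: by end_near. Qed.

End dominated_series.

(** * Multiplicativity of the quaternion norm and completeness of H *)

Section quat_norm.
Context {R : realType}.
Implicit Types (x y q : quat R).

Lemma quat_normE x :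
  `|x| = Num.sqrt (qre x ^+ 2 + qi1 x ^+ 2 + qi2 x ^+ 2 + qi3 x ^+ 2).
Proof. by []. Qed.

Lemma sqr_quat_norm x :
  `|x| ^+ 2 = qre x ^+ 2 + qi1 x ^+ 2 + qi2 x ^+ 2 + qi3 x ^+ 2.
Proof. by rewrite quat_normE sqr_sqrtr// !addr_ge0 ?sqr_ge0. Qed.

(** After squaring, this is Euler's four-square identity. *)
Lemma quat_normM x y : `|x * y| = `|x| * `|y|.
Proof.
apply/eqP; rewrite -(@eqrXn2 _ 2) ?mulr_ge0// exprMn !sqr_quat_norm /=.
by apply/eqP; ring.
Qed.

Lemma quat_norm1 : `|1 : quat R| = 1.
Proof.
by apply/eqP; rewrite -(@eqrXn2 _ 2)// sqr_quat_norm /= expr1n !expr0n/= !addr0.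
Qed.

Lemma quat_normX x n : `|x ^+ n| = `|x| ^+ n.
Proof.
elim: n => [|n IH]; first by rewrite !expr0 quat_norm1.
by rewrite !exprS quat_normM IH.
Qed.

Lemma quat_normA (k : R) : `|k%:A : quat R| = `|k|.
Proof. by rewrite normrZ quat_norm1 mulr1. Qed.

Lemma quat_norm_basis : [/\ `|1 : quat R| = 1, `|qe1 : quat R| = 1,
  `|qe2 : quat R| = 1 & `|qe3 : quat R| = 1].
Proof.
by split; rewrite ?quat_norm1// quat_normE /= expr1n !expr0n/= !(addr0, add0r) sqrtr1.
Qed.

Lemma quat_norm_conj x : `|qconj x| = `|x|.
Proof.
apply/eqP; rewrite -(@eqrXn2 _ 2)// !sqr_quat_norm /=.
by apply/eqP; ring.
Qed.

Lemma abs_qre_le x : `|qre x| <= `|x|.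
Proof.
rewrite -sqrtr_sqr quat_normE ler_wsqrtr//.
by rewrite -!addrA lerDl !addr_ge0 ?sqr_ge0.
Qed.

Lemma abs_qi1_le x : `|qi1 x| <= `|x|.
Proof.
rewrite -sqrtr_sqr quat_normE ler_wsqrtr//.
by rewrite -addrA addrAC lerDr !addr_ge0 ?sqr_ge0.
Qed.

Lemma abs_qi2_le x : `|qi2 x| <= `|x|.
Proof.
rewrite -sqrtr_sqr quat_normE ler_wsqrtr//.
by rewrite addrAC lerDr !addr_ge0 ?sqr_ge0.
Qed.

Lemma abs_qi3_le x : `|qi3 x| <= `|x|.
Proof. by rewrite -sqrtr_sqr quat_normE ler_wsqrtr// lerDr !addr_ge0 ?sqr_ge0. Qed.

Lemma quat_norm_le x : `|x| <= `|qre x| + `|qi1 x| + `|qi2 x| + `|qi3 x|.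
Proof.
rewrite -(@ler_pXn2r _ 2) ?nnegrE ?addr_ge0// sqr_quat_norm.
rewrite -(real_normK (num_real (qre x))) -(real_normK (num_real (qi1 x))).
rewrite -(real_normK (num_real (qi2 x))) -(real_normK (num_real (qi3 x))).
move: (normr_ge0 (qre x)) (normr_ge0 (qi1 x)) (normr_ge0 (qi2 x)) (normr_ge0 (qi3 x)).
move: `|qre x| `|qi1 x| `|qi2 x| `|qi3 x| => a b c d a0 b0 c0 d0.
have -> : (a + b + c + d) ^+ 2 = a ^+ 2 + b ^+ 2 + c ^+ 2 + d ^+ 2
    + (a * b + a * c + a * d + b * c + b * d + c * d) *+ 2 by ring.
by rewrite lerDl mulrn_wge0// !addr_ge0// mulr_ge0.
Qed.

(** A 1-Lipschitz function maps Cauchy filters to Cauchy filters. Applied to the four coordinates,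
    this reduces the completeness of H to that of the reals. *)
Lemma cauchy_lipschitz_cvg (F : set_system (quat R)) (phi : quat R -> R) :
  ProperFilter F -> cauchy F -> (forall x y, `|phi x - phi y| <= `|x - y|) ->
  cvg (phi @ F).
Proof.
move=> FF /cauchy_ballP Fc phi_lip; apply/cauchy_cvgP/cauchy_ballP => e e_gt0.
have [[A B] [/= FA FB] AB] := Fc e e_gt0.
exists (phi @` A, phi @` B) => /=.
  by split; [apply: filterS FA|apply: filterS FB] => x ?; exists x.
move=> _ [[x Ax <-] [y By <-]] /=; have := AB (x, y) (conj Ax By).
by rewrite -!ball_normE/=; exact: le_lt_trans.
Qed.

Lemma quat_complete (F : set_system (quat R)) :
  ProperFilter F -> cauchy F -> cvg F.
Proof.
move=> FF Fc.
have c0 : cvg (@qre R @ F).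
  by apply: cauchy_lipschitz_cvg => // x y; exact: abs_qre_le (x - y).
have c1 : cvg (@qi1 R @ F).
  by apply: cauchy_lipschitz_cvg => // x y; exact: abs_qi1_le (x - y).
have c2 : cvg (@qi2 R @ F).
  by apply: cauchy_lipschitz_cvg => // x y; exact: abs_qi2_le (x - y).
have c3 : cvg (@qi3 R @ F).
  by apply: cauchy_lipschitz_cvg => // x y; exact: abs_qi3_le (x - y).
apply/cvg_ex; exists (Quat (lim (@qre R @ F)) (lim (@qi1 R @ F))
  (lim (@qi2 R @ F)) (lim (@qi3 R @ F))).
apply/cvgrPdist_le => e e_gt0.
have e4 : 0 < e / 4 by rewrite divr_gt0.
near=> x; apply: (le_trans (quat_norm_le _)) => /=.
have -> : e = e / 4 + e / 4 + e / 4 + e / 4 by field.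
do !apply: lerD; near: x.
- by move/cvgrPdist_le : c0; exact.
- by move/cvgrPdist_le : c1; exact.
- by move/cvgrPdist_le : c2; exact.
- by move/cvgrPdist_le : c3; exact.
Unshelve. all: by end_near. Qed.

End quat_norm.

HB.instance Definition _ (R : realType) :=
  Uniform_isComplete.Build (quat R) (@quat_complete R).

(** * Algebra of the conjugation, of Q and of the sums L_n *)

Section quat_facts.
Context {R : realType}.
Implicit Types (x y q p : quat R).

Lemma qconjM x y : qconj (x * y) = qconj y * qconj x.
Proof. by apply: quat_ext => /=; ring. Qed.

Lemma qconjX x n : qconj (x ^+ n) = qconj x ^+ n.
Proof.
elim: n => [|n IH]; first by apply: quat_ext => /=; ring.
by rewrite exprS exprSr qconjM IH.
Qed.

Lemma qconj_comm x : GRing.comm x (qconj x).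
Proof. by apply: quat_ext => /=; ring. Qed.

Lemma Qpol_conj p q : Qpol p (qconj q) = qconj (Qpol p q).
Proof. by rewrite /Qpol; apply: quat_ext => /=; ring. Qed.

Lemma Qpol_comm p q : GRing.comm q (Qpol p q).
Proof. by rewrite /Qpol; apply: quat_ext => /=; ring. Qed.

Lemma QpolB_conj p q :
  Qpol p q - qconj (Qpol p q) = (2 * (qre q - qre p)) *: (q - qconj q).
Proof. by rewrite /Qpol; apply: quat_ext => /=; ring. Qed.

Lemma Lpol0 q p : Lpol 0 q p = 0.
Proof. by rewrite /Lpol big_geq. Qed.

(** The term of index 0 is the conjugate power; all the others share a right factor [Qpol p q]. This
    recursion is the one that [dirac_dpow] reproduces. *)
Lemma LpolS n q p : Lpol n.+1 q p = Lpol n q p * Qpol p q + qconj (Qpol p q ^+ n).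
Proof.
rewrite /Lpol big_nat_recl//= expr0 mulr1 addrC; congr (_ + _); last first.
  by rewrite subn0 subn1.
rewrite mulr_suml; apply: eq_big_nat => k kn.
have -> : (n.+1 - 1 - k.+1 = n - 1 - k)%N by rewrite subn1 subnS -subn1 subnAC.
by rewrite -mulrA -exprSr.
Qed.

(** The factorization of x^n - y^n for commuting x and y, with x = Q and y = conj Q. *)
Lemma Lpol_telescope n q p : Lpol n q p * (Qpol p q - qconj (Qpol p q)) =
  Qpol p q ^+ n - qconj (Qpol p q ^+ n).
Proof.
elim: n => [|n IH].
  by rewrite Lpol0 mul0r qconjX !expr0 subrr.
have comm_diff : GRing.comm (Qpol p q) (Qpol p q - qconj (Qpol p q)).
  by apply: commrB => //; exact: qconj_comm.
rewrite LpolS mulrDl -mulrA comm_diff mulrA IH mulrBl mulrBr -exprSr addrA.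
rewrite !qconjX -exprSr; congr (_ - _).
rewrite addrNK //.
Qed.

(** Each of the n summands has norm |Q|^(n-1). For n = 0 the truncated exponent is harmless, since
    the factor [n%:R] vanishes. *)
Lemma Lpol_norm_le n q p : `|Lpol n q p| <= n%:R * `|Qpol p q| ^+ n.-1.
Proof.
rewrite /Lpol (le_trans (ler_norm_sum _ _ _))//.
rewrite mulr_natl -[X in _ *+ X]subn0 -sumr_const_nat ler_sum_nat// => k kn.
rewrite quat_normM quat_norm_conj !quat_normX -exprD subn1 subnK//.
by rewrite -ltnS prednK ?(leq_ltn_trans _ kn).
Qed.

End quat_facts.

(** * Directional derivatives of powers, and the Fueter operator as a sum over directions *)

Section power_derivative.
Context {R : realType}.
Implicit Types (x y d q p e : quat R) (n : nat).

(** The noncommutative derivative of x^n along d, that is, the sum of x^k d x^(n-1-k) over k < n. *)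
Fixpoint dpow x d n : quat R :=
  if n is m.+1 then dpow x d m * x + x ^+ m * d else 0.

(** The perturbation has the shape that Q takes along a line, see [Qpol_taylor]. The bounds grow
    like s^n up to a polynomial factor in n, so they remain summable against the coefficients. The
    choice of [K] makes [K * s] dominate |d|, 1 and s at once. *)
Lemma pow_taylor x d y (s : R) n : 0 < s -> `|x| <= s -> `|y| <= 1 ->
  let K := (`|d| + 1 + s) / s in
  `|dpow x d n| <= K * n%:R * s ^+ n /\
  forall t : R, `|t| <= 1 -> `|x + t *: d + t ^+ 2 *: y| <= s ->
  let x' := x + t *: d + t ^+ 2 *: y in
  `|x' ^+ n - x ^+ n| <= `|t| * (K * n%:R * s ^+ n) /\
  `|x' ^+ n - x ^+ n - t *: dpow x d n| <= t ^+ 2 * ((K * n%:R) ^+ 2 * s ^+ n).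
Proof.
move=> s_gt0 xs y1 K; set M := `|d| + 1 + s.
have KM : M = K * s by rewrite /K divfK// gt_eqF.
have K1 : 1 <= K by rewrite /K ler_pdivlMr// mul1r lerDr addr_ge0.
have dM : `|d| <= M by rewrite /M -addrA lerDl addr_ge0// ltW.
have s_ge0 := ltW s_gt0; have K_ge0 : 0 <= K := le_trans ler01 K1.
have xXs k : `|x ^+ k| <= s ^+ k by rewrite quat_normX lerXn2r// nnegrE.
split.
  elim: n => [|n IH]; first by rewrite /= normr0 mulr0 mul0r.
  rewrite /= (le_trans (ler_normD _ _))// !quat_normM.
  have -> : K * n.+1%:R * s ^+ n.+1 = K * n%:R * s ^+ n * s + s ^+ n * (K * s).
    by rewrite -natr1 exprS; ring.
  by rewrite -KM lerD// ler_pM.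
move=> t t1; set x' := x + t *: d + t ^+ 2 *: y => x's.
have x'Xs k : `|x' ^+ k| <= s ^+ k by rewrite quat_normX lerXn2r// nnegrE.
have x'B : x' - x = t *: d + t ^+ 2 *: y.
  by rewrite /x' -[X in X - _]addrA addrAC subrr add0r.
have x'B_le : `|x' - x| <= `|t| * M.
  rewrite x'B (le_trans (ler_normD _ _))// !normrZ /M -addrA mulrDr lerD2l.
  rewrite -mulrA ler_wpM2l// (le_trans _ (_ : 1 <= _))//.
    by rewrite -[1]mulr1 ler_pM.
  by rewrite lerDl.
have pow_diff k : `|x' ^+ k - x ^+ k| <= `|t| * (K * k%:R * s ^+ k).
  elim: k => [|k IH]; first by rewrite !expr0 subrr normr0 mulr0 mul0r mulr0.
  have -> : x' ^+ k.+1 - x ^+ k.+1 = (x' ^+ k - x ^+ k) * x' + x ^+ k * (x' - x).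
    by rewrite !exprSr mulrBl mulrBr addrA subrK.
  rewrite (le_trans (ler_normD _ _))// !quat_normM.
  have -> : `|t| * (K * k.+1%:R * s ^+ k.+1) =
      `|t| * (K * k%:R * s ^+ k) * s + s ^+ k * (`|t| * (K * s)).
    by rewrite -natr1 exprS; ring.
  by rewrite -KM lerD// ler_pM.
split=> //.
elim: n => [|n IH].
  by rewrite /= !expr0 subrr scaler0 subr0 normr0 mulr_ge0 ?sqr_ge0// mulr_ge0// sqr_ge0.
(* The old remainder times x, plus two terms of order [t ^+ 2]: the first because the difference of
   powers is itself of order t, the second by its explicit factor. *)
have -> : x' ^+ n.+1 - x ^+ n.+1 - t *: dpow x d n.+1 =
    (x' ^+ n - x ^+ n - t *: dpow x d n) * x +
    (t *: ((x' ^+ n - x ^+ n) * d) + t ^+ 2 *: (x' ^+ n * y)).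
  have x'X : x' ^+ n.+1 = x' ^+ n * (x + t *: d + t ^+ 2 *: y) by rewrite exprSr.
  rewrite x'X /= [x ^+ n.+1]exprSr.
  move: (x' ^+ n) (x ^+ n) (dpow x d n) => A B C.
  by apply: quat_ext => /=; ring.
apply: (le_trans (ler_normD _ _)).
rewrite quat_normM.
have h1 : `|x' ^+ n - x ^+ n - t *: dpow x d n| * `|x| <=
    t ^+ 2 * ((K * n%:R) ^+ 2 * s ^+ n) * s by rewrite ler_pM.
apply: (le_trans (lerD h1 (ler_normD _ _))).
have h2 : `|t *: ((x' ^+ n - x ^+ n) * d)| <= t ^+ 2 * (K * n%:R * s ^+ n * (K * s)).
  rewrite normrZ quat_normM -KM -(real_normK (num_real t)) expr2 -!mulrA.
  by rewrite ler_wpM2l// !mulrA ler_pM// -!mulrA (le_trans (pow_diff n))// !mulrA.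
have h3 : `|t ^+ 2 *: (x' ^+ n * y)| <= t ^+ 2 * s ^+ n.
  rewrite normrZ ger0_norm ?sqr_ge0// ler_wpM2l ?sqr_ge0// quat_normM.
  by rewrite -[leRHS]mulr1 ler_pM.
apply: (le_trans (lerD (lexx _) (lerD h2 h3))).
rewrite -[t ^+ 2 * _ * s]mulrA -!mulrDr.
apply: ler_wpM2l; first exact: sqr_ge0.
(* Both [K] and [K * s] are at least 1. *)
have s1 : s ^+ n <= K ^+ 2 * s ^+ n.+1.
  rewrite [s ^+ n.+1]exprS mulrA ler_peMl ?exprn_ge0// expr2 -mulrA -KM.
  rewrite -[1]mulr1 ler_pM// /M.
  by rewrite -addrA addrCA lerDl addr_ge0.
apply: (@le_trans _ _ ((K * n%:R) ^+ 2 * s ^+ n.+1 + K ^+ 2 * n%:R * s ^+ n.+1 +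
    K ^+ 2 * s ^+ n.+1)).
  rewrite addrA lerD// le_eqVlt [s ^+ n.+1]exprS.
  by apply/orP; left; apply/eqP; ring.
(* The slack is n, because (n+1)^2 = (n^2 + n + 1) + n. *)
rewrite -subr_ge0 -natr1.
have -> : (K * (n%:R + 1)) ^+ 2 * s ^+ n.+1 -
    ((K * n%:R) ^+ 2 * s ^+ n.+1 + K ^+ 2 * n%:R * s ^+ n.+1 + K ^+ 2 * s ^+ n.+1)
    = K ^+ 2 * n%:R * s ^+ n.+1 by ring.
by rewrite mulr_ge0 ?exprn_ge0// mulr_ge0 ?exprn_ge0.
Qed.

(** The algebraic part of [fueter], acting on a directional derivative seen as a function of the
    direction; it commutes with right multiplication. *)
Definition dirac (d : quat R -> quat R) : quat R :=
  d 1 + qe1 * d qe1 + qe2 * d qe2 + qe3 * d qe3.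

Lemma diracD F1 F2 : dirac (fun e => F1 e + F2 e) = dirac F1 + dirac F2.
Proof. by rewrite /dirac !mulrDr !addrA; apply: quat_ext => /=; ring. Qed.

Lemma dirac_mulr F x : dirac (fun e => F e * x) = dirac F * x.
Proof. by rewrite /dirac !mulrDl !mulrA. Qed.

Lemma dirac_mull x : dirac (fun e => x * e) = - 2 * qconj x.
Proof. by rewrite /dirac; apply: quat_ext => /=; ring. Qed.

Definition dQpol p q e : quat R := q * e + e * q - (2 * qre p) *: e.

(** Exact, since Q is quadratic; [e ^+ 2] plays the role of [y] in [pow_taylor]. *)
Lemma Qpol_taylor p q e (t : R) :
  Qpol p (q + t *: e) = Qpol p q + t *: dQpol p q e + t ^+ 2 *: e ^+ 2.
Proof. by rewrite /Qpol /dQpol; apply: quat_ext => /=; ring. Qed.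

(** By [dirac_mull] the three terms of [dQpol] contribute - 2 conj (x q), - 2 (conj x) q and 4 p_0
    conj x. Commutation turns conj (x q) into (conj x)(conj q), and q + conj q = 2 q_0. It is used
    with x a power of Q. *)
Lemma dirac_dQpol p q x : GRing.comm x q ->
  dirac (fun e => x * dQpol p q e) = - 4 * (qre q - qre p)%:A * qconj x.
Proof.
move=> xq; transitivity
    (- 2 * qconj (x * q) + (- 2 * qconj x * q + (4 * qre p) *: qconj x)).
  by rewrite /dirac /dQpol; apply: quat_ext => /=; ring.
by rewrite xq qconjM; apply: quat_ext => /=; ring.
Qed.

Lemma dirac_dpow p q n :
  dirac (fun e => dpow (Qpol p q) (dQpol p q e) n) =
  - 4 * (qre q - qre p)%:A * Lpol n q p.
Proof.
elim: n => [|n IH]; first by rewrite /dirac Lpol0 !mulr0 !addr0.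
rewrite diracD dirac_mulr IH dirac_dQpol ?LpolS ?mulrDr ?mulrA//.
by apply/commr_sym/commrX/Qpol_comm.
Qed.

End power_derivative.

(** * Continuity of Q and bounds on compact subsets of the Cassini ball *)

Section quat_continuity.
Context {R : realType}.
Implicit Types p q e : quat R.

(** Squeeze the norm of f g - a b = (f - a) g + a (g - b). *)
Lemma cvg_quatM {T : Type} {F : set_system T} {FF : Filter F}
    {f g : T -> quat R} {a b : quat R} :
  f @ F --> a -> g @ F --> b -> f x * g x @[x --> F] --> a * b.
Proof.
move=> fa gb; apply/subr_cvg0/norm_cvg0P.
have fa0 : `|f x - a| @[x --> F] --> (0 : R) by apply/norm_cvg0P/subr_cvg0.
have gb0 : `|g x - b| @[x --> F] --> (0 : R) by apply/norm_cvg0P/subr_cvg0.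
have ub : `|f x - a| * `|g x| + `|a| * `|g x - b| @[x --> F] -->
    (0 * `|b| + `|a| * 0 : R).
  apply: cvgD; first by apply: cvgM => //; exact: cvg_norm.
  by apply: cvgM => //; exact: cvg_cst.
rewrite mul0r mulr0 addr0 in ub.
apply: squeeze_cvgr (cvg_cst 0) ub; apply: nearW => x; rewrite normr_ge0/=.
rewrite -!quat_normM (le_trans _ (ler_normD _ _))// mulrBl mulrBr.
by rewrite addrA subrK.
Qed.

Lemma Qpol_continuous p : continuous (Qpol p).
Proof.
move=> q; have cq : x @[x --> q] --> q by exact: cvg_id.
exact: (cvgD (cvgB (cvg_quatM cq cq) (cvgZl_tmp (k := 2 * qre p) cq))
  (cvg_cst ((`|p| ^+ 2)%:A : quat R))).
Qed.

(** The maximum of |Q| on a nonempty [K] is attained, hence lies strictly below [r ^+ 2]; taking [s]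
    midway keeps it positive even if that maximum is 0. *)
Lemma compact_cassini_bound {p} {r : R} {K : set (quat R)} :
  0 < r -> compact K -> K `<=` cassini p r ->
  exists s B, [/\ 0 < s, s < r ^+ 2 &
    forall q, K q -> `|Qpol p q| <= s /\ `|q| <= B].
Proof.
move=> r_gt0 cK KE; have r2_gt0 : 0 < r ^+ 2 by rewrite exprn_gt0.
have [B [_ /(_ (B + 1))]] := compact_bounded cK.
rewrite ltrDl ltr01 => /(_ isT) KB.
have [[q0 Kq0]|K0] := pselect (K !=set0); last first.
  exists (r ^+ 2 / 2), 0; split; [lra|lra|move=> q Kq].
  by case: K0; exists q.
have [q1 /set_mem Kq1 q1max] : exists2 q1, q1 \in K &
    forall q, q \in K -> `|Qpol p q| <= `|Qpol p q1|.
  apply: compact_EVT_max => //; first by exists q0.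
  apply: continuous_subspaceT => q.
  by apply: (cvg_norm (Qpol_continuous p q)).
have Q1r : `|Qpol p q1| < r ^+ 2 := KE _ Kq1.
have Q1_ge0 := normr_ge0 (Qpol p q1).
exists ((`|Qpol p q1| + r ^+ 2) / 2), (B + 1); split; [lra|lra|move=> q Kq].
split; last exact: KB.
by apply: (le_trans (q1max _ (mem_set Kq))); lra.
Qed.

End quat_continuity.

(** * Polynomial weights do not affect convergence inside the radius *)

Section weights.
Context {R : realType}.
Implicit Types (w : nat -> R) (s rho : R).

Lemma bernoulli_le (h : R) n : 0 <= h -> 1 + n%:R * h <= (1 + h) ^+ n.
Proof.
move=> h0; elim: n => [|n IH]; first by rewrite expr0 mul0r addr0.
rewrite exprS (le_trans _ (ler_wpM2l _ IH)) ?addr_ge0// -natr1.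
have : 0 <= n%:R * h * h by rewrite !mulr_ge0.
by set N : R := n%:R; nra.
Qed.

(** Compare with the series at t = s (1 + h), midway between s and rho: by Bernoulli, n + 1 is at
    most (1 + 1/h) (1 + h)^n. *)
Lemma cvg_series_natr_weight {w rho} :
  (forall n, 0 <= w n) ->
  (forall s, 0 < s -> s < rho -> cvgn (series (fun n => s ^+ n * w n))) ->
  forall s, 0 < s -> s < rho -> cvgn (series (fun n => s ^+ n * (n.+1%:R * w n))).
Proof.
move=> w0 cw s s0 srho; pose t := (s + rho) / 2.
have st : s < t by rewrite /t; lra.
have t0 : 0 < t := lt_trans s0 st.
pose h := t / s - 1.
have h0 : 0 < h by rewrite /h subr_gt0 ltr_pdivlMr// mul1r.
have ct := cw t t0; rewrite {1}/t in ct.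
have {}ct := @is_cvg_seriesZ R _ (1 + h^-1) (ct ltac:(lra)).
apply: series_le_cvg ct => n.
- by rewrite !mulr_ge0// exprn_ge0// ltW.
- by rewrite !mulr_ge0// ?addr_ge0 ?invr_ge0 ?exprn_ge0 ?ltW.
rewrite [leRHS]mulrA mulrA ler_wpM2r//.
have -> : t = s * (1 + h) by rewrite /h addrC subrK mulrCA divff ?gt_eqF// mulr1.
rewrite exprMn mulrCA ler_wpM2l ?exprn_ge0 ?(ltW s0)//.
apply: le_trans (ler_wpM2l _ (bernoulli_le h n (ltW h0))); last first.
  by rewrite addr_ge0// invr_ge0 ltW.
have -> : (1 + h^-1) * (1 + n%:R * h) = n.+1%:R + (h^-1 + n%:R * h).
  by rewrite -natr1; field; rewrite gt_eqF.
by rewrite lerDl addr_ge0 ?invr_ge0 ?mulr_ge0// ltW.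
Qed.

Lemma cvg_series_sqr_weight {w rho} :
  (forall n, 0 <= w n) ->
  (forall s, 0 < s -> s < rho -> cvgn (series (fun n => s ^+ n * w n))) ->
  forall s, 0 < s -> s < rho ->
    cvgn (series (fun n => s ^+ n * (n.+1%:R ^+ 2 * w n))).
Proof.
move=> w0 cw s s0 srho.
have w1 n : 0 <= n.+1%:R * w n by rewrite mulr_ge0.
have := cvg_series_natr_weight w1 (cvg_series_natr_weight w0 cw) s s0 srho.
by congr (cvgn (series _)); apply/funext => n; rewrite expr2 !mulrA.
Qed.

End weights.

(** * Families of terms dominated on the sets where |Q| <= s and |q| <= B *)

Section domination.
Context {R : realType}.
Variables (p : quat R) (w : nat -> R).
Hypothesis w_ge0 : forall n, 0 <= w n.
Implicit Types (u v y : nat -> quat R -> quat R) (q : quat R).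

(** The bound [B] controls factors such as q - p and q_0 - p_0, which |Q| does not bound uniformly
    in form. The weight [n.+1%:R ^+ 2] is the one that also serves the Taylor remainders. The next
    two predicates separate the growth in n from the coefficients. *)
Definition cassini_dominated u := forall s B : R, 0 < s ->
  exists C, forall q n, `|Qpol p q| <= s -> `|q| <= B ->
    `|u n q| <= C * (s ^+ n * (n.+1%:R ^+ 2 * w n)).

Definition cassini_sqr_power u := forall s B : R, 0 < s ->
  exists C, forall q n, `|Qpol p q| <= s -> `|q| <= B ->
    `|u n q| <= C * (s ^+ n * n.+1%:R ^+ 2).

Definition locally_weight_bounded u := forall B : R,
  exists C, forall q n, `|q| <= B -> `|u n q| <= C * w n.

Lemma cassini_dominatedM v y : cassini_sqr_power v -> locally_weight_bounded y ->
  cassini_dominated (fun n q => v n q * y n q).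
Proof.
move=> vP yP s B s0; have [C vC] := vP s B s0; have [D yD] := yP B.
exists (C * D) => q n Qs qB; rewrite quat_normM.
rewrite [s ^+ n * _]mulrA [C * D * _]mulrACA.
by rewrite ler_pM//; [exact: vC|exact: yD].
Qed.

(** Used with [h] the identity or the conjugation, one for each form of the expansion. *)
Lemma locally_weight_bounded_affine (b c : nat -> quat R) (h : quat R -> quat R) :
  (forall n, `|b n| + `|c n| <= w n) -> (forall q, `|h q| = `|q|) ->
  locally_weight_bounded (fun n q => b n + (h q - p) * c n).
Proof.
move=> bcw hE B; exists (1 + (B + `|p|)) => q n qB.
have B0 : 0 <= B + `|p| by rewrite addr_ge0// (le_trans _ qB).
rewrite (le_trans (ler_normD _ _))// quat_normM.
have hp : `|h q - p| <= B + `|p|.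
  by rewrite (le_trans (ler_normB _ _))// hE lerD2r.
have := bcw n; have := normr_ge0 (b n); have := normr_ge0 (c n).
have := ler_wpM2r (normr_ge0 (c n)) hp.
move: `|h q - p| (B + _) B0 `|b n| `|c n| (w n) => H M M0 x z W' *; nra.
Qed.

Lemma locally_weight_bounded_cst (b : nat -> quat R) :
  (forall n, `|b n| <= w n) -> locally_weight_bounded (fun n q => b n).
Proof. by move=> bw B; exists 1 => q n _; rewrite mul1r. Qed.

Lemma Qpow_sqr_power : cassini_sqr_power (fun n q => Qpol p q ^+ n).
Proof.
move=> s B s0; exists 1 => q n Qs _; rewrite mul1r quat_normX.
apply: (le_trans (lerXn2r n _ _ Qs)); rewrite ?nnegrE ?(ltW s0)//.
by rewrite ler_peMr ?exprn_ge0 ?(ltW s0)// exprn_ege1// ler1n.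
Qed.

Lemma Qpow_conj_sqr_power : cassini_sqr_power (fun n q => Qpol p (qconj q) ^+ n).
Proof.
move=> s B s0; have [C QC] := Qpow_sqr_power s B s0; exists C => q n Qs qB.
by apply: QC; rewrite ?Qpol_conj quat_norm_conj.
Qed.

Lemma Lpol_sqr_power :
  cassini_sqr_power (fun n q => Lpol n q p * (qre q - qre p)%:A).
Proof.
move=> s B s0; exists (s^-1 * (B + `|p|)) => q n Qs qB.
have s_ge0 := ltW s0.
rewrite quat_normM quat_normA mulrAC ler_pM//; last first.
  rewrite (le_trans (ler_normB _ _))// lerD ?abs_qre_le//.
  exact: le_trans (abs_qre_le q) qB.
(* The factor [s^-1] makes up for the exponent n - 1 in the bound on L_n. *)
apply: (le_trans (Lpol_norm_le n q p)); case: n => [|n] /=.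
  by rewrite mul0r !mulr_ge0 ?invr_ge0.
rewrite [s ^+ n.+1]exprS -[s * _ * _]mulrA mulKf ?gt_eqF// mulrC.
apply: ler_pM => //.
  by rewrite lerXn2r// nnegrE.
rewrite (le_trans (_ : _ <= n.+2%:R))// ?ler_nat//.
by rewrite expr2 ler_peMr// ler1n.
Qed.

Variable r : R.
Hypothesis r_gt0 : 0 < r.
Hypothesis w_cvg : forall s, 0 < s -> s < r ^+ 2 ->
  cvgn (series (fun n => s ^+ n * w n)).

Lemma cassini_dominated_compact u (K : set (quat R)) :
  cassini_dominated u -> compact K -> K `<=` cassini p r ->
  exists c, cvgn (series c) /\ forall n q, K q -> `|u n q| <= c n.
Proof.
move=> uP cK KE; have [s [B [s0 sr KsB]]] := compact_cassini_bound r_gt0 cK KE.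
have [C uC] := uP s B s0.
exists (fun n => C * (s ^+ n * (n.+1%:R ^+ 2 * w n))); split.
  exact: (@is_cvg_seriesZ R _ C (cvg_series_sqr_weight w_ge0 w_cvg s s0 sr)).
by move=> n q /KsB[]; exact: uC.
Qed.

Lemma cassini_dominated_pointwise {u} : cassini_dominated u ->
  forall q, cassini p r q ->
  exists c, cvgn (series c) /\ forall n, `|u n q| <= c n.
Proof.
move=> uP q Eq.
have [|c [cc uc]] := cassini_dominated_compact _ _ uP (@compact_set1 _ q).
  by move=> _ ->.
by exists c; split => // n; exact: uc.
Qed.

Lemma cassini_dominated_cvgn {u} m : cassini_dominated u ->
  forall q, cassini p r q -> cvgn (fun N => \sum_(m <= n < N) u n q).
Proof.
move=> uP q /(cassini_dominated_pointwise uP)[c [cc uc]].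
exact: (dominated_cvgn m uc cc).
Qed.

Lemma cassini_dominated_cvg_abs_unif u m : cassini_dominated u ->
  cvg_abs_unif_compacts (cassini p r) m u.
Proof.
move=> uP; split=> [q /(cassini_dominated_pointwise uP)[c [cc uc]]|K cK KE].
  exact: (dominated_cvgn_norm m uc cc).
have [c [cc uc]] := cassini_dominated_compact _ _ uP cK KE.
exact: (weierstrass_M_test _ _ _ _ uc cc).
Qed.

End domination.

(** * The merged spherical series and its termwise Fueter derivative *)

Section spherical_term.
Context {R : realType}.
Variables (p : quat R) (b c : nat -> quat R) (w : nat -> R).
Hypothesis bcw : forall n, `|b n| + `|c n| <= w n.
Implicit Types (q e : quat R).

Definition sterm n q : quat R := Qpol p q ^+ n * (b n + (q - p) * c n).

Definition dsterm n q e : quat R :=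
  dpow (Qpol p q) (dQpol p q e) n * (b n + (q - p) * c n) +
  Qpol p q ^+ n * e * c n.

Lemma dirac_dsterm n q : dirac (dsterm n q) =
  - 4 * (Lpol n q p * (qre q - qre p)%:A * (b n + (q - p) * c n)) -
  2 * (Qpol p (qconj q) ^+ n * c n).
Proof.
rewrite /dsterm diracD !dirac_mulr dirac_dpow dirac_mull qconjX -Qpol_conj.
move: (Lpol n q p) (Qpol p (qconj q) ^+ n) (b n + _) => L Q z.
by apply: quat_ext => /=; ring.
Qed.

(** The difference of the two sides is the defect of [Lpol_telescope], multiplied by - 2 on the left
    and by [c n] on the right. *)
Lemma sterm_forms n q :
  - 4 * (Lpol n q p * (qre q - qre p)%:A * (b n + (q - p) * c n)) -
  2 * (Qpol p (qconj q) ^+ n * c n) =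
  - 4 * (Lpol n q p * (qre q - qre p)%:A * (b n + (qconj q - p) * c n)) -
  2 * (Qpol p q ^+ n * c n).
Proof.
apply/subr0_eq; transitivity (- 2 * ((Lpol n q p * (Qpol p q - qconj (Qpol p q)) -
    (Qpol p q ^+ n - qconj (Qpol p q ^+ n))) * c n)).
  rewrite QpolB_conj Qpol_conj qconjX.
  move: (Lpol n q p) (Qpol p q ^+ n) (qconj (Qpol p q) ^+ n) (c n) (b n).
  by move=> L Q Q' y z; apply: quat_ext => /=; ring.
by rewrite Lpol_telescope subrr mul0r mulr0.
Qed.

(** One constant serves both estimates, so a single summable sequence feeds [is_derive_series] as
    derivative bound and as remainder bound. *)
Lemma sterm_taylor q e (s : R) : 0 < s -> `|e| = 1 -> `|Qpol p q| <= s ->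
  exists C, (forall n, `|dsterm n q e| <= C * (s ^+ n * (n.+1%:R ^+ 2 * w n))) /\
  forall t n, `|t| <= 1 -> `|Qpol p (q + t *: e)| <= s ->
    `|sterm n (q + t *: e) - sterm n q - t *: dsterm n q e| <=
    t ^+ 2 * (C * (s ^+ n * (n.+1%:R ^+ 2 * w n))).
Proof.
move=> s0 e1 Qs; pose d := dQpol p q e; pose K := (`|d| + 1 + s) / s.
have s_ge0 := ltW s0.
have K1 : 1 <= K by rewrite /K ler_pdivlMr// mul1r lerDr addr_ge0.
have e2 : `|e ^+ 2| <= 1 by rewrite quat_normX e1 expr1n.
pose m := `|q - p|; have m0 : 0 <= m := normr_ge0 _.
have w0 n : 0 <= w n by apply: le_trans (bcw n); rewrite addr_ge0.
have cw n : `|c n| <= w n by apply: le_trans (bcw n); rewrite lerDr.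
have zw n : `|b n + (q - p) * c n| <= (1 + m) * w n.
  rewrite (le_trans (ler_normD _ _))// quat_normM -/m.
  have := bcw n; have := normr_ge0 (b n); have := normr_ge0 (c n).
  by move: `|b n| `|c n| (w n) => x y W; nra.
have K2 : 1 <= K ^+ 2 by rewrite exprn_ege1.
have K0 : 0 <= K := le_trans ler01 K1.
(* The derivative costs K n + 1 and the remainder (K n)^2 + K n; both fit under this common
   bound. *)
have KK2 n : (K * n%:R) ^+ 2 + K * n%:R + 1 <= K ^+ 2 * n.+1%:R ^+ 2.
  have N0 : 0 <= n%:R :> R by [].
  have KN : K * n%:R <= K ^+ 2 * n%:R by rewrite ler_wpM2r// expr2 ler_peMr.
  have -> : K ^+ 2 * n.+1%:R ^+ 2 =
      (K * n%:R) ^+ 2 + K ^+ 2 * n%:R + K ^+ 2 + K ^+ 2 * n%:R.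
    by rewrite -natr1; ring.
  by rewrite -[leLHS]addr0 !lerD// mulr_ge0// (le_trans ler01).
have KK n : K * n%:R + 1 <= K ^+ 2 * n.+1%:R ^+ 2.
  by rewrite (le_trans _ (KK2 n))// lerD2r lerDr sqr_ge0.
have KK' n : (K * n%:R) ^+ 2 + K * n%:R <= K ^+ 2 * n.+1%:R ^+ 2.
  by rewrite (le_trans _ (KK2 n))// lerDl.
exists (K ^+ 2 * (1 + m)); split=> [n|t n t1 Qts].
  have [dn _] := pow_taylor _ d _ _ n s0 Qs e2; rewrite -/K in dn.
  rewrite /dsterm (le_trans (ler_normD _ _))// !quat_normM e1 mulr1 quat_normX.
  have h1 : `|dpow (Qpol p q) d n| * `|b n + (q - p) * c n| <=
    (K * n%:R * s ^+ n) * ((1 + m) * w n) by rewrite ler_pM.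
  have h2 : `|Qpol p q| ^+ n * `|c n| <= s ^+ n * ((1 + m) * w n).
    rewrite ler_pM ?exprn_ge0//; first by rewrite lerXn2r// nnegrE.
    by rewrite (le_trans (cw n))// ler_peMl// lerDl.
  apply: (le_trans (lerD h1 h2)).
  rewrite [leLHS](_ : _ = (K * n%:R + 1) * (s ^+ n * ((1 + m) * w n))); last by ring.
  rewrite [leRHS](_ : _ = (K ^+ 2 * n.+1%:R ^+ 2) * (s ^+ n * ((1 + m) * w n)));
    last by ring.
  by rewrite ler_wpM2r// !mulr_ge0 ?exprn_ge0 ?addr_ge0.
have [_ /(_ t t1)] := pow_taylor _ d _ _ n s0 Qs e2.
rewrite -Qpol_taylor => /(_ Qts); rewrite -/K => -[dA rA].
have -> : sterm n (q + t *: e) - sterm n q - t *: dsterm n q e =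
    (Qpol p (q + t *: e) ^+ n - Qpol p q ^+ n - t *: dpow (Qpol p q) d n) *
      (b n + (q - p) * c n) +
    t *: ((Qpol p (q + t *: e) ^+ n - Qpol p q ^+ n) * e * c n).
  rewrite /sterm /dsterm -/d.
  move: (Qpol p (q + _) ^+ n) (Qpol p q ^+ n) (dpow _ _ _) (b n) (c n) => A A' D z y.
  by apply: quat_ext => /=; ring.
have h1 : `|(Qpol p (q + t *: e) ^+ n - Qpol p q ^+ n - t *: dpow (Qpol p q) d n) *
      (b n + (q - p) * c n)| <=
    t ^+ 2 * ((K * n%:R) ^+ 2 * s ^+ n) * ((1 + m) * w n).
  by rewrite quat_normM ler_pM.
have h2 : `|t *: ((Qpol p (q + t *: e) ^+ n - Qpol p q ^+ n) * e * c n)| <=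
    t ^+ 2 * (K * n%:R * s ^+ n) * ((1 + m) * w n).
  rewrite normrZ !quat_normM e1 mulr1 -(real_normK (num_real t)) expr2.
  rewrite mulrA ler_pM ?mulr_ge0//.
    by rewrite -[leRHS]mulrA ler_wpM2l.
  by rewrite (le_trans (cw n))// ler_peMl// lerDl.
apply: (le_trans (ler_normD _ _)); apply: (le_trans (lerD h1 h2)).
rewrite [leLHS](_ : _ = t ^+ 2 *
  (((K * n%:R) ^+ 2 + K * n%:R) * (s ^+ n * ((1 + m) * w n)))); last by ring.
rewrite [leRHS](_ : _ = t ^+ 2 *
  ((K ^+ 2 * n.+1%:R ^+ 2) * (s ^+ n * ((1 + m) * w n)))); last by ring.
by rewrite ler_wpM2l ?sqr_ge0// ler_wpM2r// !mulr_ge0 ?exprn_ge0 ?addr_ge0.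
Qed.

Lemma dirac_sum (d : nat -> quat R -> quat R) N :
  dirac (fun e => \sum_(0 <= n < N) d n e) = \sum_(0 <= n < N) dirac (d n).
Proof. by rewrite /dirac !mulr_sumr -!big_split. Qed.

(** [dirac] evaluates its argument only at 1, [qe1], [qe2] and [qe3], all of norm 1. *)
Lemma cvg_dirac (d : nat -> quat R -> quat R) (l : quat R -> quat R) :
  (forall e, `|e| = 1 -> (fun N => d N e) @ \oo --> l e) ->
  (fun N => dirac (d N)) @ \oo --> dirac l.
Proof.
move=> dl; apply: cvgD; [apply: cvgD; [apply: cvgD|]|];
  try (apply: cvg_quatM; first exact: cvg_cst); apply: dl;
  by have [] := @quat_norm_basis R.
Qed.

Variable r : R.
Hypothesis r_gt0 : 0 < r.
Hypothesis w_cvg : forall s, 0 < s -> s < r ^+ 2 ->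
  cvgn (series (fun n => s ^+ n * w n)).

Let w_ge0 n : 0 <= w n.
Proof. by apply: le_trans (bcw n); rewrite addr_ge0. Qed.

Lemma sterm_dominated : cassini_dominated p w sterm.
Proof.
apply: cassini_dominatedM; first exact: Qpow_sqr_power.
exact: (locally_weight_bounded_affine _ _ _ _ id).
Qed.

Lemma is_derive_sterm_series (f : quat R -> quat R) q e :
  (forall x, cassini p r x -> f x = \sum_(0 <= n <oo) sterm n x) ->
  cassini p r q -> `|e| = 1 ->
  cvgn (fun N => \sum_(0 <= n < N) dsterm n q e) /\
  is_derive q e f (\sum_(0 <= n <oo) dsterm n q e).
Proof.
move=> fE Eq e1; have Qr : `|Qpol p q| < r ^+ 2 := Eq.
have Q_ge0 := normr_ge0 (Qpol p q).
pose s := (`|Qpol p q| + r ^+ 2) / 2.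
have r2_gt0 : 0 < r ^+ 2 by rewrite exprn_gt0.
have [s0 sr Qs] : [/\ 0 < s, s < r ^+ 2 & `|Qpol p q| < s].
  by rewrite /s; split; lra.
have [C [dC rC]] := sterm_taylor q e s s0 e1 (ltW Qs).
have cC : cvgn (series (fun n => C * (s ^+ n * (n.+1%:R ^+ 2 * w n)))).
  exact: (@is_cvg_seriesZ R _ C (cvg_series_sqr_weight w_ge0 w_cvg s s0 sr)).
split; first exact: (dominated_cvgn 0 dC cC).
pose M := `|dQpol p q e| + 1.
have M0 : 0 < M by rewrite ltr_wpDl.
(* For |t| <= 1, Q moves by at most |t| [M] along the line, so it stays within norm [s]. *)
pose delta := Num.min 1 ((s - `|Qpol p q|) / M).
have delta0 : 0 < delta by rewrite lt_min ltr01 divr_gt0// subr_gt0.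
have near_q t : `|t| < delta -> `|t| <= 1 /\ `|Qpol p (q + t *: e)| <= s.
  rewrite lt_min => /andP[/ltW t1]; rewrite ltr_pdivlMr// => tM; split=> //.
  rewrite Qpol_taylor -addrA (le_trans (ler_normD _ _))// -lerBrDl.
  apply: le_trans (ltW tM).
  rewrite (le_trans (ler_normD _ _))// !normrZ quat_normX e1 expr1n mulr1.
  rewrite /M mulrDr mulr1 lerD2l.
  by rewrite ler_piMr.
have in_cassini t : `|t| < delta -> cassini p r (q + t *: e).
  by move=> /near_q[_ Qts]; exact: le_lt_trans sr.
apply: (is_derive_series delta0 _ _ dC cC cC).
- move=> t /in_cassini; apply: (cassini_dominated_cvgn _ _ w_ge0 _ r_gt0 w_cvg).
  exact: sterm_dominated.
- by move=> t /in_cassini; exact: fE.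
- by move=> t n /near_q[]; exact: rC.
Qed.

(** [L] and [Q] are left abstract so that both forms follow from the same argument; [L 0 = 0]
    reconciles the summation from 1 with the series from 0. *)
Lemma fueter_sterm_series (f : quat R -> quat R) q (L Q : nat -> quat R) :
  (forall x, cassini p r x -> f x = \sum_(0 <= n <oo) sterm n x) ->
  cassini p r q -> L 0%N = 0 ->
  (forall n, dirac (dsterm n q) = - 4 * L n - 2 * Q n) ->
  cvgn (fun N => \sum_(1 <= n < N) L n) -> cvgn (fun N => \sum_(0 <= n < N) Q n) ->
  fueter f q = - 4 * (\sum_(1 <= n <oo) L n) - 2 * (\sum_(0 <= n <oo) Q n).
Proof.
move=> fE Eq L0 LQ cL cQ.
have fueterE : fueter f q = dirac (fun e => \sum_(0 <= n <oo) dsterm n q e).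
  have D e : `|e| = 1 -> 'D_e f q = \sum_(0 <= n <oo) dsterm n q e.
    by move=> /(is_derive_sterm_series f q e fE Eq)[_ ?]; exact: derive_val.
  by have [n0 n1 n2 n3] := @quat_norm_basis R; rewrite /fueter /dirac !D.
have lim1 : (fun N => dirac (fun e => \sum_(0 <= n < N) dsterm n q e)) @ \oo -->
    fueter f q.
  rewrite fueterE; apply: cvg_dirac => e e1.
  by have [] := is_derive_sterm_series f q e fE Eq e1.
have lim2 : (fun N => - 4 * (\sum_(1 <= n < N) L n) - 2 * (\sum_(0 <= n < N) Q n))
    @ \oo --> - 4 * (\sum_(1 <= n <oo) L n) - 2 * (\sum_(0 <= n <oo) Q n).
  by apply: cvgB; apply: cvg_quatM; [exact: cvg_cst|exact: cL|exact: cvg_cst|exact: cQ].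
apply: (cvg_unique _ lim1); first exact: norm_hausdorff.
rewrite [X in X @ _](_ : _ = fun N =>
  - 4 * (\sum_(1 <= n < N) L n) - 2 * (\sum_(0 <= n < N) Q n))//.
apply/funext => N; rewrite dirac_sum (eq_bigr _ (fun n _ => LQ n)) sumrB -!mulr_sumr.
congr (_ * _ - _); case: N => [|N]; first by rewrite !big_geq.
by rewrite big_ltn// L0 add0r.
Qed.

End spherical_term.

(** * Summability of the coefficients from absolute convergence *)

Section summability.
Context {R : realType}.
Implicit Types (p : quat R) (s r : R).

(* On the sphere of radius [sqrt (|Im p|^2 + s)] around [Re p], [Q_p] is [- s]. *)
Lemma Qpol_attains p s : 0 <= s -> exists q, Qpol p q = - s%:A.
Proof.
move=> s0; pose v := Num.sqrt (qi1 p ^+ 2 + qi2 p ^+ 2 + qi3 p ^+ 2 + s).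
exists (Quat (qre p) v 0 0).
have v2 : v ^+ 2 = qi1 p ^+ 2 + qi2 p ^+ 2 + qi3 p ^+ 2 + s.
  by rewrite sqr_sqrtr// !addr_ge0 ?sqr_ge0.
have -> : - s%:A = (qi1 p ^+ 2 + qi2 p ^+ 2 + qi3 p ^+ 2 - v ^+ 2)%:A :> quat R.
  by rewrite v2 -scaleNr; congr (_ *: _); ring.
by rewrite /Qpol sqr_quat_norm; apply: quat_ext => /=; ring.
Qed.

Lemma Qpol_center p : Qpol p p = 0.
Proof. by rewrite /Qpol sqr_quat_norm; apply: quat_ext => /=; ring. Qed.

(** Evaluate both series at a point where Q = - s. There q differs from p, as Q vanishes at p, so
    the constant factor |q - p| can be divided out of the odd series. *)
Lemma cassini_coef_summable p r (b c : nat -> quat R) :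
  (forall q, cassini p r q -> cvgn (fun N =>
     \sum_(0 <= n < N) `|Qpol p q ^+ n * b n|)) ->
  (forall q, cassini p r q -> cvgn (fun N =>
     \sum_(0 <= n < N) `|Qpol p q ^+ n * (q - p) * c n|)) ->
  forall s, 0 < s -> s < r ^+ 2 ->
  cvgn (series (fun n => s ^+ n * (`|b n| + `|c n|))).
Proof.
move=> cb cc s s0 sr; have [q Qq] := Qpol_attains p s (ltW s0).
have Qs : `|Qpol p q| = s by rewrite Qq normrN quat_normA gtr0_norm.
have Eq : cassini p r q by rewrite /cassini/= Qs.
have qp : `|q - p| != 0.
  rewrite normr_eq0 subr_eq0; apply/eqP => qp.
  by move: Qs; rewrite qp Qpol_center normr0 => s00; rewrite -s00 ltxx in s0.
have cc' := @is_cvg_seriesZ R _ (`|q - p|^-1) (cc q Eq).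
have := is_cvg_seriesD (cb q Eq) cc'.
rewrite [X in series X](_ : _ = fun n => s ^+ n * (`|b n| + `|c n|))//.
apply/funext => n.
rewrite [LHS]/(_ + _ *: _) !quat_normM quat_normX Qs mulrDr; congr (_ + _).
by rewrite [X in _ *: X]mulrAC [X in _ *: X]mulrC; exact: (mulKf qp).
Qed.

End summability.

(** * Derivation of both expansions of g and of their convergence *)

Theorem theorem5p13 (R : realType) (p : quat R) (r : R) (U : set (quat R))
    (f g : quat R -> quat R) (a : nat -> quat R)
    (r_gt0 : 0 < r) (U_open : open U) (U_sym : axially_symmetric U)
    (Up : U p) (cassini_sub : cassini p r `<=` U)
    (f_slice : slice_hyperholomorphic U f)
    (cvg_even : cvg_abs_unif_compacts (cassini p r) 0
       (fun n q => Qpol p q ^+ n * a (2 * n)%N))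
    (cvg_odd : cvg_abs_unif_compacts (cassini p r) 0
       (fun n q => Qpol p q ^+ n * (q - p) * a (2 * n + 1)%N))
    (f_expansion : forall q, cassini p r q ->
       f q = \sum_(0 <= n <oo) (Qpol p q ^+ n * a (2 * n)%N) +
             \sum_(0 <= n <oo) (Qpol p q ^+ n * (q - p) * a (2 * n + 1)%N))
    (g_def : forall q, U q -> g q = fueter f q) :
  (forall q, cassini p r q -> fueter_derivable f q) /\
  ((forall q, cassini p r q ->
      g q = - 4 * (\sum_(1 <= n <oo) (Lpol n q p * (qre q - qre p)%:A *
                     (a (2 * n)%N + (qconj q - p) * a (2 * n + 1)%N)))
            - 2 * (\sum_(0 <= n <oo) (Qpol p q ^+ n * a (2 * n + 1)%N))) /\
   cvg_abs_unif_compacts (cassini p r) 1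
     (fun n q => Lpol n q p * (qre q - qre p)%:A *
                   (a (2 * n)%N + (qconj q - p) * a (2 * n + 1)%N)) /\
   cvg_abs_unif_compacts (cassini p r) 0
     (fun n q => Qpol p q ^+ n * a (2 * n + 1)%N)) /\
  ((forall q, cassini p r q ->
      g q = - 4 * (\sum_(1 <= n <oo) (Lpol n q p * (qre q - qre p)%:A *
                     (a (2 * n)%N + (q - p) * a (2 * n + 1)%N)))
            - 2 * (\sum_(0 <= n <oo) (Qpol p (qconj q) ^+ n *
                                       a (2 * n + 1)%N))) /\
   cvg_abs_unif_compacts (cassini p r) 1
     (fun n q => Lpol n q p * (qre q - qre p)%:A *
                   (a (2 * n)%N + (q - p) * a (2 * n + 1)%N)) /\
   cvg_abs_unif_compacts (cassini p r) 0
     (fun n q => Qpol p (qconj q) ^+ n * a (2 * n + 1)%N)).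
Proof.
pose b n := a (2 * n)%N; pose c n := a (2 * n + 1)%N.
pose w n := `|b n| + `|c n|.
have bcw n : `|b n| + `|c n| <= w n by [].
have w_ge0 n : 0 <= w n by rewrite addr_ge0.
have cw n : `|c n| <= w n by rewrite lerDr.
have w_cvg : forall s, 0 < s -> s < r ^+ 2 ->
    cvgn (series (fun n => s ^+ n * w n)).
  exact: cassini_coef_summable cvg_even.1 cvg_odd.1.
pose unif := cassini_dominated_cvg_abs_unif p w w_ge0 r r_gt0 w_cvg.
pose ptw := cassini_dominated_cvgn p w w_ge0 r r_gt0 w_cvg.
have domL1 : cassini_dominated p w (fun n q =>
    Lpol n q p * (qre q - qre p)%:A * (b n + (qconj q - p) * c n)).
  apply: (cassini_dominatedM _ _ _ _ (Lpol_sqr_power p)).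
  exact: locally_weight_bounded_affine bcw quat_norm_conj.
have domL2 : cassini_dominated p w (fun n q =>
    Lpol n q p * (qre q - qre p)%:A * (b n + (q - p) * c n)).
  apply: (cassini_dominatedM _ _ _ _ (Lpol_sqr_power p)).
  exact: (locally_weight_bounded_affine _ _ _ _ id).
have domQ1 : cassini_dominated p w (fun n q => Qpol p q ^+ n * c n).
  apply: (cassini_dominatedM _ _ _ _ (Qpow_sqr_power p)).
  exact: locally_weight_bounded_cst.
have domQ2 : cassini_dominated p w (fun n q => Qpol p (qconj q) ^+ n * c n).
  apply: (cassini_dominatedM _ _ _ _ (Qpow_conj_sqr_power p)).
  exact: locally_weight_bounded_cst.
(* Absolute convergence gives convergence of each series by completeness, so their partial sums may
   be added and regrouped. *)
have fE q : cassini p r q -> f q = \sum_(0 <= n <oo) sterm p b c n q.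
  move=> Eq; rewrite f_expansion//.
  have cb := normed_cvg (cvg_even.1 q Eq).
  have cc := normed_cvg (cvg_odd.1 q Eq).
  apply/esym/cvg_lim; first exact: norm_hausdorff.
  rewrite (_ : (fun N => _) = fun N => \sum_(0 <= n < N) (Qpol p q ^+ n * b n) +
    \sum_(0 <= n < N) (Qpol p q ^+ n * (q - p) * c n)).
    by apply: cvgD; [exact: cb|exact: cc].
  apply/funext => N; rewrite -big_split/=; apply: eq_bigr => n _.
  by rewrite /sterm mulrDr mulrA.
split.
  have fd q e : cassini p r q -> `|e| = 1 -> derivable f q e.
    move=> Eq e1.
    by have [_ []] := is_derive_sterm_series p b c w bcw r r_gt0 w_cvg f q e fE Eq e1.
  by move=> q Eq; have [] := @quat_norm_basis R; split; exact: fd.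
have fueterE := fueter_sterm_series p b c w bcw r r_gt0 w_cvg f _ _ _ fE.
split; split.
- move=> q Eq; rewrite g_def; last exact: cassini_sub.
  apply: fueterE => //; first by rewrite Lpol0 !mul0r.
  (* The termwise derivative arrives in the second form; [sterm_forms] converts it to the first. *)
  + by move=> n; rewrite dirac_dsterm sterm_forms.
  + exact: ptw domL1 q Eq.
  + exact: ptw domQ1 q Eq.
- by split; [exact: unif domL1|exact: unif domQ1].
- move=> q Eq; rewrite g_def; last exact: cassini_sub.
  apply: fueterE => //; first by rewrite Lpol0 !mul0r.
  + by move=> n; rewrite dirac_dsterm.
  + exact: ptw domL2 q Eq.
  + exact: ptw domQ2 q Eq.
- by split; [exact: unif domL2|exact: unif domQ2].
Qed.
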